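(* Let $d\geq 1$, let $\mathbb K$ be a field of characteristic zero, let $k\geq1$, let $\mathbf p=(p_1,\dots,p_k)$ be a vector of polynomials in $\mathbb Z[i,j_1,\dots,j_{d-1},n]$ of total degree at most one, and let $\mathbf m=(m_1,\dots,m_k)$ be a vector of positive integers. For every $\mathbf r\in \prod_{q=1}^k\{0,\dots,m_q-1\}$ let $\mathbf S_{\mathbf r}\subseteq\mathbb Z^d$ be a finite set and $w_{\mathbf r}\colon \mathbf S_{\mathbf r}\to\mathbb K$ a function. Fix a starting point $(i_0,\mathbf j_0)\in\mathbb Z_{\geq0}\times\mathbb Z^{d-1}$. Consider walks starting at $(i_0,\mathbf j_0)$ that stay in the half-space $\mathbb Z_{\geq0}\times\mathbb Z^{d-1}$ (every position visited has nonnegative first coordinate), subject to the rule that whenever the walk is at position $(i,\mathbf j)$ after $n$ steps, its $(n+1)$st step must be taken from $\mathbf S_{\mathbf r}$ with $\mathbf r=\mathbf p(i,\mathbf j,n)\bmod \mathbf m$ (evaluation and reduction taken componentwise); such a step $(u,\mathbf v)\in\mathbf S_{\mathbf r}$ has weight $w_{\mathbf r}(u,\mathbf v)$, and the weight of a walk is the product of the weights of its steps. Let $f_{i,\mathbf j,n}$ be the sum of the weights of all such walks of length $n$ ending at $(i,\mathbf j)$, and let $F(x,\mathbf y,t)=\sum_{i,\mathbf j,n} f_{i,\mathbf j,n}x^i\mathbf y^{\mathbf j}t^n\in\mathbb K[x,\mathbf y,\mathbf y^{-1}][[t]]$, where $\mathbf y=(y_1,\dots,y_{d-1})$ and $\mathbf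 y^{\mathbf j}=y_1^{j_1}\cdots y_{d-1}^{j_{d-1}}$. Then $F(x,\mathbf y,t)$ is algebraic over $\mathbb K[x,\mathbf y,t]$. *)

(* Defs.v *)
From HB Require Import structures.
From mathcomp Require Import all_boot all_order all_algebra.
From mathcomp Require Import finmap mpoly boolp.

Set Implicit Arguments.
Unset Strict Implicit.
Unset Printing Implicit Defensive.

Import Order.TTheory GRing.Theory Num.Theory.

Local Open Scope ring_scope.

Section PowerSeries.
Context (R : comNzRingType).

Record series : Type := Series { scoef : nat -> R }.

HB.instance Definition _ := gen_eqMixin series.
HB.instance Definition _ := gen_choiceMixin series.

Implicit Types f g h : series.

Lemma seriesP f g : (forall n, scoef f n = scoef g n) -> f = g.
Proof. by case: f g => [f] [g] /= fg; congr Series; apply: funext. Qed.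

Definition sconst (c : R) := Series (fun n => if n == 0%N then c else 0).
Definition sX := Series (fun n => (n == 1%N)%:R).
Definition sopp f := Series (fun n => - scoef f n).
Definition sadd f g := Series (fun n => scoef f n + scoef g n).
Definition smul f g :=
  Series (fun n => \sum_(i < n.+1) scoef f i * scoef g (n - i)%N).

Lemma saddA : associative sadd.
Proof. by move=> f g h; apply: seriesP => n /=; rewrite addrA. Qed.
Lemma saddC : commutative sadd.
Proof. by move=> f g; apply: seriesP => n /=; rewrite addrC. Qed.
Lemma sadd0 : left_id (sconst 0) sadd.
Proof. by move=> f; apply: seriesP => n /=; rewrite if_same add0r. Qed.
Lemma saddN : left_inverse (sconst 0) sopp sadd.
Proof. by move=> f; apply: seriesP => n /=; rewrite if_same addNr. Qed.

HB.instance Definition _ :=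
  GRing.isZmodule.Build series saddA saddC sadd0 saddN.

Let trunc N f : {poly R} := \poly_(i < N) scoef f i.

Let smul_trunc N f g n : (n < N)%N ->
  scoef (smul f g) n = (trunc N f * trunc N g)`_n.
Proof.
move=> nN; rewrite coefM /=; apply: eq_bigr => i _; rewrite !coef_poly.
have iN : (i < N)%N by apply: leq_ltn_trans nN; rewrite -ltnS.
by rewrite iN (leq_ltn_trans (leq_subr i n) nN).
Qed.

Lemma smulC : commutative smul.
Proof.
by move=> f g; apply: seriesP => n; rewrite !(@smul_trunc n.+1) // mulrC.
Qed.

Lemma smulA : associative smul.
Proof.
move=> f g h; apply: seriesP => n.
have truncM u v w : (trunc n.+1 (smul u v) * w)`_n
    = (trunc n.+1 u * trunc n.+1 v * w)`_n.
  rewrite !coefM; apply: eq_bigr => i _; congr (_ * _).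
  by rewrite coef_poly ltn_ord (@smul_trunc n.+1).
rewrite (@smul_trunc n.+1) // [RHS](@smul_trunc n.+1) // truncM mulrC truncM.
by rewrite mulrC mulrA.
Qed.

Lemma smul1 : left_id (sconst 1) smul.
Proof.
move=> f; apply: seriesP => n /=; rewrite big_ord_recl /= subn0 mul1r.
by rewrite big1 ?addr0 // => i _; rewrite mul0r.
Qed.

Lemma smulDl : left_distributive smul sadd.
Proof.
move=> f g h; apply: seriesP => n /=; rewrite -big_split /=.
by apply: eq_bigr => i _; rewrite mulrDl.
Qed.

Lemma sone_neq0 : sconst 1 != 0 :> series.
Proof.
apply/eqP => /(congr1 (fun f => scoef f 0)) /= /eqP.
by rewrite oner_eq0.
Qed.

HB.instance Definition _ :=
  GRing.Zmodule_isComNzRing.Build series smulA smulC smul1 smulDl sone_neq0.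

End PowerSeries.

(* The analogue for arbitrary rings of [algebraicOver], which is restricted to
   fields. *)
Definition algebraic_over (R S : nzRingType) (f : R -> S) (u : S) :=
  exists2 P : {poly R}, P != 0 & root (map_poly f P) u.

(* In {mpoly K[1 + e]} the variable of index [lshift e ord0] is x and the one
   of index [rshift 1 a] is y_a; in {mpoly K[1 + e + 1]} the last variable is
   added to these. *)
Section Laurent.
Context (K : fieldType) (e : nat).

Local Notation ratfun := {fraction {mpoly K[1 + e]}}.

Definition varx : ratfun := tofrac 'X_(lshift e ord0).
Definition vary (a : 'I_e) : ratfun := tofrac 'X_(rshift 1 a).

(* K[x, y, y^-1], as a subring of the field K(x, y) *)
Definition is_laurent : {pred ratfun} := fun u =>
  `[< exists N (g : {mpoly K[1 + e]}), u * (\prod_a vary a) ^+ N = tofrac g >].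

Lemma laurent_poly (g : {mpoly K[1 + e]}) : tofrac g \in is_laurent.
Proof. by apply/asboolP; exists 0%N, g; rewrite expr0 mulr1. Qed.

Lemma laurent_prod : \prod_a vary a = tofrac (\prod_a 'X_(rshift 1 a)).
Proof. by rewrite rmorph_prod. Qed.

Lemma laurent_subring : subring_closed is_laurent.
Proof.
split; first by have := laurent_poly 1; rewrite rmorph1.
- move=> u v /asboolP[M [g gE]] /asboolP[N [h hE]]; apply/asboolP.
  exists (M + N)%N.
  exists (g * (\prod_a 'X_(rshift 1 a)) ^+ N
          - h * (\prod_a 'X_(rshift 1 a)) ^+ M).
  rewrite rmorphB !rmorphM !rmorphXn /= -laurent_prod -gE -hE mulrBl exprD.
  by rewrite mulrA [X in _ - v * X]mulrC mulrA.
- move=> u v /asboolP[M [g gE]] /asboolP[N [h hE]]; apply/asboolP.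
  by exists (M + N)%N, (g * h); rewrite exprD mulrACA gE hE -rmorphM.
Qed.

HB.instance Definition _ :=
  GRing.isSubringClosed.Build ratfun is_laurent laurent_subring.

Record laurent : Type :=
  Laurent { laurent_val :> ratfun; laurentP : laurent_val \in is_laurent }.

HB.instance Definition _ := [isSub for laurent_val].
HB.instance Definition _ := [Choice of laurent by <:].
HB.instance Definition _ := [SubChoice_isSubComNzRing of laurent by <:].

Definition laurent_of_mpoly (g : {mpoly K[1 + e]}) : laurent :=
  Laurent (laurent_poly g).

Lemma vary_neq0 a : vary a != 0.
Proof. by rewrite tofrac_eq0 -msupp_eq0 msuppX. Qed.

Lemma laurent_monomial_subproof (i : nat) (j : 'rV[int]_e) :
  varx ^+ i * \prod_a vary a ^ j 0 a \in is_laurent.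
Proof.
have laurent_y a : vary a \in is_laurent by apply: laurent_poly.
have laurent_yV a : (vary a)^-1 \in is_laurent.
  apply/asboolP; exists 1%N, (\prod_(b | b != a) 'X_(rshift 1 b)).
  by rewrite expr1 (bigD1 a) //= mulKf ?vary_neq0 // rmorph_prod.
apply: rpredM; first by apply: rpredX; apply: laurent_poly.
apply: rpred_prod => a _; case: (j 0 a) => n.
  exact: (rpredX n (laurent_y a)).
by rewrite NegzE -exprnN -exprVn; exact: (rpredX n.+1 (laurent_yV a)).
Qed.

Definition laurent_monomial (i : nat) (j : 'rV[int]_e) : laurent :=
  Laurent (laurent_monomial_subproof i j).

(* the inclusion of K[x, y, t] into K[x, y, y^-1][[t]] *)
Definition series_of_mpoly : {mpoly K[1 + e + 1]} -> series laurent :=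
  mmap (fun c => sconst (laurent_of_mpoly c%:MP))
       (fun a => match split a with
                 | inl b => sconst (laurent_of_mpoly 'X_b)
                 | inr _ => sX laurent
                 end).

End Laurent.

(* Z^d as Z x Z^(d-1), with e = d - 1 *)
Notation point e := (int * 'rV[int]_e)%type.

Notation residue m := {dffun forall q, 'I_(m q)}.

Section Walks.

Definition mod_ord_subproof (m : nat) (hm : (0 < m)%N) (a : int) :
  (`|(a %% m)%Z|%N < m)%N.
Proof.
have m_neq0 : (m%:Z != 0) by rewrite -lt0n.
by rewrite -ltz_nat gez0_abs ?modz_ge0 // ltz_pmod.
Qed.

Definition mod_ord (m : nat) (hm : (0 < m)%N) (a : int) : 'I_m :=
  Ordinal (mod_ord_subproof hm a).

Context (e k : nat) (m : 'I_k -> nat) (hm : forall q, (0 < m q)%N).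
Context (p : 'I_k -> {mpoly int[1 + e + 1]}).

Definition eval_vector (z : point e) (n : nat) : 'I_(1 + e + 1) -> int :=
  fun a => row_mx (row_mx (const_mx z.1) z.2) (const_mx n%:Z) (0 : 'I_1) a.

Definition residue_at (z : point e) (n : nat) : residue m :=
  [ffun q => mod_ord (hm q) (p q).@[eval_vector z n]].

Context (K : fieldType) (S : residue m -> {fset point e}).
Context (w : forall r : residue m, S r -> K).
Context (i0 : nat) (j0 : 'rV[int]_e).

Definition all_steps : {fset point e} :=
  (\bigcup_(r <- enum {: residue m}) S r)%fset.

Definition position (s : seq (point e)) (l : nat) : point e :=
  (i0%:Z, j0) + \sum_(a <- take l s) a.

Definition rule_at (s : seq (point e)) (l : nat) : residue m :=
  residue_at (position s l) l.

Definition is_walk (s : seq (point e)) : bool :=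
  [forall l : 'I_(size s), nth 0 s l \in S (rule_at s l)] &&
  [forall l : 'I_(size s).+1, 0 <= (position s l).1].

(* w r extended by 0 outside S r; a walk only uses its values on S r *)
Definition step_weight (r : residue m) (a : point e) : K :=
  oapp (@w r) 0 (insub a).

Definition walk_weight (s : seq (point e)) : K :=
  \prod_(l < size s) step_weight (rule_at s l) (nth 0 s l).

Definition steps_of n (s : n.-tuple all_steps) : seq (point e) := map val s.

Definition walk_sum (i : nat) (j : 'rV[int]_e) (n : nat) : K :=
  \sum_(s : n.-tuple all_steps
        | is_walk (steps_of s) && (position (steps_of s) n == (i%:Z, j)))
     walk_weight (steps_of s).

Definition endpoints (n : nat) : {fset nat * 'rV[int]_e} :=
  [fset (`|(position (steps_of s) n).1|%N, (position (steps_of s) n).2)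
     | s : n.-tuple all_steps & is_walk (steps_of s)]%fset.

Lemma walk_sum_endpoints i j n :
  walk_sum i j n != 0 -> (i, j) \in endpoints n.
Proof.
apply: contraNT => ij_notin; rewrite /walk_sum big1 // => s /andP[s_walk /eqP sE].
case/imfsetP: ij_notin; exists s; first by [].
by rewrite sE.
Qed.

(* F(x, y, t); every (i, j) with f_(i,j,n) != 0 lies in [endpoints n] *)
Definition walk_gf : series (laurent K e) :=
  Series (fun n => \sum_(z <- endpoints n)
    laurent_of_mpoly (walk_sum z.1 z.2 n)%:MP * laurent_monomial K z.1 z.2).

End Walks.

(* Main.v *)
(* Since the p_q are affine, the residue governing the next step is updated
   deterministically by each step, so the walk is a half-line walk in the first
   coordinate with finitely many states, whose weights lie in the field
   k = K(x, y). With a catalytic variable X for the first coordinate and all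
   steps shifted by X^b, the vector F in k[X][[t]]^N of generating functions
   satisfies the kernel equation
       B F = X^b f_0 - H,   B = X^b - t A,   deg_X H < b.
   Weierstrass preparation gives det B = P U with P monic, P = X^(bN) and U = 1
   modulo t. Multiplying the kernel equation by adj B shows that P divides a
   polynomial in X as a power series, hence that G = U F is polynomial in X.
   The coefficients of the monic factor P of det B, hence those of U, are
   algebraic over k(t). The pair (H, G) is the only solution with deg H < b of
   the linear system U (X^b f_0 - H) = B G (look at the lowest coefficient in t),
   so its coefficients lie in the algebraic closure of k(t) in k((t)) as well;
   now put X = x in F = G / U. *)
Require Import Defs.
From HB Require Import structures.
From mathcomp Require Import all_boot all_order all_algebra all_field.
From mathcomp Require Import finmap mpoly boolp generic_quotient zify.

Set Implicit Arguments.
Unset Strict Implicit.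
Unset Printing Implicit Defensive.

Import Order.TTheory GRing.Theory Num.Theory.

Local Open Scope ring_scope.

(** * Relative algebraic closure and descent of linear systems *)

(** A nonconstant divisor of least size is irreducible. *)
Lemma irreducible_factor (F : fieldType) (P : {poly F}) : (1 < size P)%N ->
  exists2 q, irreducible_poly q & q %| P.
Proof.
move=> P_gt1.
pose good n := `[< exists q : {poly F}, [/\ size q = n, (1 < n)%N & q %| P] >].
have exg : exists n, good n by exists (size P); apply/asboolP; exists P.
case: (ex_minnP exg) => n /asboolP[q [qn n_gt1 qP]] nmin.
exists q => //; split; first by rewrite qn.
move=> r r_neq1 rq; rewrite -dvdp_size_eqp // eqn_leq.
have q_neq0 : q != 0 by rewrite -size_poly_gt0 qn ltnW.
rewrite (dvdp_leq q_neq0 rq) /= qn; apply: nmin; apply/asboolP; exists r.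
split=> //; last exact: dvdp_trans qP.
rewrite ltn_neqAle eq_sym r_neq1 size_poly_gt0.
by apply: contraTneq rq => ->; rewrite dvd0p.
Qed.

Lemma algebraic_map (k E F : fieldType) (phi : {rmorphism k -> E})
    (psi : {rmorphism E -> F}) u :
  algebraicOver (psi \o phi) (psi u) <-> algebraicOver phi u.
Proof.
by split=> -[q q0 qu]; exists q; move: qu => //; rewrite map_poly_comp fmorph_root.
Qed.

(** Induction on the degree of [P]: adjoin a root [z] of an irreducible factor and write
    [P = P1 * ('X - z%:P)]. The element [z] is algebraic as a root of [D], the coefficients of [P1]
    are algebraic by induction, and those of [P] are polynomial expressions in both. *)
Lemma algebraic_coef_monic_factor (k E : fieldType) (phi : {rmorphism k -> E})
    (D : {poly k}) (P : {poly E}) :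
  D != 0 -> P \is monic -> P %| map_poly phi D ->
  forall i, algebraicOver phi P`_i.
Proof.
move=> D0; have [n] := ubnP (size P).
(* [E] is generalized because the induction hypothesis is applied over the extension [L]. *)
elim: n => // n IHn in E phi P *; rewrite ltnS => sP Pmon PD i.
have [P_le1|P_gt1] := leqP (size P) 1.
  have sP1 : size P = 1%N.
    by apply/eqP; rewrite eqn_leq P_le1 size_poly_gt0 monic_neq0.
  move: Pmon; rewrite (size1_polyC P_le1) monicE lead_coefC => /eqP ->.
  by rewrite coefC; case: ifP => _; [apply: algebraic1 | apply: algebraic0].
have [q qirr qP] := irreducible_factor P_gt1.
have [L _ [z qz _]] := irredp_FAdjoin qirr.
pose psi : {rmorphism E -> L} := in_alg L.
have Pz : root (map_poly psi P) z.
  by apply: root_dvdp qz; rewrite dvdp_map.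
have [P1 P1E] := factor_theorem _ _ Pz.
have P1mon : P1 \is monic.
  by rewrite -(monicMr _ (monicXsubC z)) -P1E map_monic.
have PD' : map_poly psi P %| map_poly (psi \o phi) D.
  by rewrite map_poly_comp dvdp_map.
have P1alg := IHn L (psi \o phi) P1 _ P1mon _.
apply/(algebraic_map phi psi); rewrite -coef_map P1E.
have zalg : algebraicOver (psi \o phi) z.
  by exists D => //; apply: root_dvdp PD' Pz.
have sP1 : (size P1 < n)%N.
  have := congr1 (fun p : {poly L} => size p) P1E.
  rewrite size_map_poly size_Mmonic ?monicXsubC ?monic_neq0 // size_XsubC addn2 /=.
  by move=> <-.
have P1D : P1 %| map_poly (psi \o phi) D.
  by apply: dvdp_trans PD'; rewrite P1E dvdp_mulr.
rewrite mulrBr coefB coefMX coefMC; apply: algebraic_sub.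
  by case: ifP => _; [apply: algebraic0 | apply: P1alg].
by apply: algebraic_mul => //; apply: P1alg.
Qed.

Section DivringSubtype.
Variables (F : fieldType) (S : divringClosed F).

Record divring_sub : Type :=
  DivringSub { divring_val :> F; divring_subP : divring_val \in S }.

HB.instance Definition _ := [isSub for divring_val].
HB.instance Definition _ := [Choice of divring_sub by <:].
HB.instance Definition _ := [SubChoice_isSubUnitRing of divring_sub by <:].
HB.instance Definition _ := [SubNzRing_isSubComNzRing of divring_sub by <:].
HB.instance Definition _ := [SubComUnitRing_isSubIntegralDomain of divring_sub by <:].
HB.instance Definition _ := [SubIntegralDomain_isSubField of divring_sub by <:].

End DivringSubtype.

Lemma divring_closed_subfield (F : fieldType) (S : {pred F}) :
  divring_closed S -> exists (L : fieldType) (psi : {rmorphism L -> F}),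
    forall u, u \in S <-> exists l, psi l = u.
Proof.
move=> S_closed.
pose S' : divringClosed F := HB.pack S (GRing.isDivringClosed.Build F S S_closed).
exists (divring_sub S'), (\val : {rmorphism divring_sub S' -> F}) => u; split=> [uS | [l <-]].
  by exists (@DivringSub _ S' u uS).
exact: divring_subP.
Qed.

(** The relative algebraic closure is given as a field of its own with an embedding, so that
    polynomial division and linear algebra can take place over it. *)
Lemma algebraic_subfield (k E : fieldType) (phi : {rmorphism k -> E}) :
  exists (L : fieldType) (psi : {rmorphism L -> E}),
    forall u, algebraicOver phi u <-> exists l, psi l = u.
Proof.
pose S : {pred E} := fun u => `[< algebraicOver phi u >].
have SP u : u \in S <-> algebraicOver phi u by split=> /asboolP.
have [|L [psi psiP]] := @divring_closed_subfield E S.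
  split=> [|u v /SP uA /SP vA|u v /SP uA /SP vA]; apply/SP.
  - exact: algebraic1.
  - exact: algebraic_sub.
  - exact: algebraic_div.
by exists L, psi => u; rewrite -SP psiP.
Qed.

(** A system over [L] that is solvable over [E] is solvable over [L]; the trivial kernel over [E]
    then identifies the two solutions. *)
Lemma linear_system_descent (L E : fieldType) (psi : {rmorphism L -> E})
    (I J : finType) (a : J -> I -> L) (c : J -> L) (v : I -> E) :
  (forall j, \sum_i psi (a j i) * v i = psi (c j)) ->
  (forall w, (forall j, \sum_i psi (a j i) * w i = 0) -> forall i, w i = 0) ->
  forall i, exists l, psi l = v i.
Proof.
move=> av aker i.
pose A := \matrix_(i < #|I|, j < #|J|) a (enum_val j) (enum_val i).
pose C := \row_(j < #|J|) c (enum_val j).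
have mulA (w : 'rV_#|I|) j : (w *m map_mx psi A) 0 j
    = \sum_i psi (a (enum_val j) i) * w 0 (enum_rank i).
  rewrite mxE (reindex (@enum_rank I) (onW_bij _ (enum_rank_bij I))) /=.
  apply: eq_bigr => i' _; by rewrite !mxE enum_rankK mulrC.
have vA : (\row_i v (enum_val i)) *m map_mx psi A = map_mx psi C.
  apply/rowP => j; rewrite mulA !mxE -av.
  by apply: eq_bigr => i' _; rewrite mxE enum_rankK.
(* Solvability is an inclusion of row spaces, which does not depend on the field of scalars. *)
have /submxP[l lA] : (C <= A)%MS by rewrite -(map_submx psi) -vA submxMl.
exists (l 0 (enum_rank i)); apply/eqP; rewrite -subr_eq0; apply/eqP.
pose w : 'rV_#|I| := map_mx psi l - \row_i v (enum_val i).
have wA : w *m map_mx psi A = 0 by rewrite mulmxBl -map_mxM -lA vA subrr.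
suff /(_ i) : forall i, w 0 (enum_rank i) = 0 by rewrite !mxE enum_rankK.
apply: (aker (fun i => w 0 (enum_rank i))) => j.
by have := mulA w (enum_rank j); rewrite wA mxE enum_rankK => <-.
Qed.

Lemma coef_bounded_sum (R : comNzRingType) (p q : {poly R}) s n : (size q <= s)%N ->
  (p * q)`_n = \sum_(l < s) (p * 'X^l)`_n * q`_l.
Proof.
move=> sq; rewrite -{1}(take_poly_id sq) /take_poly poly_def mulr_sumr coef_sum.
by apply: eq_bigr => l _; rewrite -scalerAr coefZ mulrC.
Qed.

(** The scalar unknowns are the coefficients of [v i] below [s i]; comparing coefficients turns the
    polynomial equations into linear ones. *)
Lemma poly_system_descent (L E : fieldType) (psi : {rmorphism L -> E})
    (I J : finType) (s : I -> nat) (a : J -> I -> {poly L}) (c : J -> {poly L})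
    (v : I -> {poly E}) :
  (forall i, (size (v i) <= s i)%N) ->
  (forall j, \sum_i map_poly psi (a j i) * v i = map_poly psi (c j)) ->
  (forall w : I -> {poly E}, (forall i, (size (w i) <= s i)%N) ->
     (forall j, \sum_i map_poly psi (a j i) * w i = 0) -> forall i, w i = 0) ->
  forall i, exists l, map_poly psi l = v i.
Proof.
move=> sv av aker.
pose T := {i : I & 'I_(s i)}.
(* From index [N] on the left-hand sides have no coefficients, so finitely many scalar equations
   suffice for uniqueness. *)
pose N := \max_(z : J * T) size (a z.1 (tag z.2) * 'X^(tagged z.2))%R.
have sum_coef (w : I -> {poly E}) j n : (forall i, (size (w i) <= s i)%N) ->
    (\sum_i map_poly psi (a j i) * w i)`_n
      = \sum_(x : T) psi (a j (tag x) * 'X^(tagged x))`_n * (w (tag x))`_(tagged x).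
  move=> sw; rewrite coef_sum.
  rewrite -(sig_big_dep xpredT (fun _ _ => true) (fun i (l : 'I_(s i)) =>
     psi (a j i * 'X^l)`_n * (w i)`_l)) /=.
  apply: eq_bigr => i _; rewrite (coef_bounded_sum _ _ (sw i)).
  by apply: eq_bigr => l _; rewrite -coef_map rmorphM /= map_polyXn.
have eq0_bounded j n (x : T) : (N <= n)%N -> (a j (tag x) * 'X^(tagged x))`_n = 0.
  move=> Nn; apply: nth_default; apply: leq_trans Nn.
  exact: (leq_bigmax (j, x)).
have coefs (x : T) : exists l, psi l = (v (tag x))`_(tagged x).
  apply: (@linear_system_descent L E psi T (J * 'I_N)%type
    (fun jn x => (a jn.1 (tag x) * 'X^(tagged x))`_jn.2) (fun jn => (c jn.1)`_jn.2)
    (fun x => (v (tag x))`_(tagged x))) => [[j n]|w wker y] /=.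
    by rewrite -sum_coef // av coef_map.
  pose W i := \poly_(l < s i)
    oapp (fun l' : 'I_(s i) => w (Tagged (fun i => 'I_(s i)) l')) 0 (insub l).
  have Ww (z : T) : (W (tag z))`_(tagged z) = w z.
    by rewrite coef_poly ltn_ord valK; case: z.
  have sW i : (size (W i) <= s i)%N by apply: size_poly.
  rewrite -Ww (aker W) ?coef0 // => j; apply/polyP => n; rewrite sum_coef // coef0.
  under eq_bigr do rewrite Ww.
  have [nN|Nn] := ltnP n N; first exact: (wker (j, Ordinal nN)).
  by rewrite big1 // => z _; rewrite eq0_bounded // rmorph0 mul0r.
move=> i; have [l lE] := choice (fun z : 'I_(s i) => coefs (Tagged (fun i => 'I_(s i)) z)).
exists (\poly_(n < s i) oapp l 0 (insub n)).
apply/polyP => n; rewrite coef_map coef_poly.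
case: ltnP => [ns|sn]; last first.
  by rewrite nth_default ?(leq_trans (sv i)) //; apply: rmorph0.
by rewrite (insubT (fun n => n < s i)%N ns) /= lE.
Qed.

(** * Power series and Weierstrass preparation *)

Section SeriesTheory.
Variable R : comNzRingType.
Implicit Types f g : series R.

Lemma scoefD f g n : scoef (f + g) n = scoef f n + scoef g n.
Proof. by []. Qed.

Lemma scoefN f n : scoef (- f) n = - scoef f n.
Proof. by []. Qed.

Lemma scoef0 n : scoef (0 : series R) n = 0.
Proof. exact: if_same. Qed.

Lemma scoef1 n : scoef (1 : series R) n = (n == 0%N)%:R.
Proof. by rewrite [LHS]/=; case: eqP. Qed.

Lemma scoefM f g n : scoef (f * g) n = \sum_(i < n.+1) scoef f i * scoef g (n - i)%N.
Proof. by []. Qed.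

Lemma scoef_sum I (r : seq I) (P : pred I) (F : I -> series R) n :
  scoef (\sum_(i <- r | P i) F i) n = \sum_(i <- r | P i) scoef (F i) n.
Proof.
by apply: (big_morph (fun f => scoef f n)) => [f g|]; rewrite ?scoefD ?scoef0.
Qed.

Lemma series_eqP f g : f = g <-> forall n, scoef f n = scoef g n.
Proof. by split=> [->|/seriesP]. Qed.

Lemma scoef_sconstM c f n : scoef (sconst c * f) n = c * scoef f n.
Proof.
rewrite scoefM big_ord_recl subn0 /= big1 ?addr0 // => i _.
by rewrite mul0r.
Qed.

Lemma scoef_sXM f n : scoef (sX R * f) n.+1 = scoef f n.
Proof.
rewrite scoefM 2!big_ord_recl /= mul0r add0r subSS subn0 mul1r big1 ?addr0 // => i _.
by rewrite mul0r.
Qed.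

Lemma scoef_sXM0 f : scoef (sX R * f) 0 = 0.
Proof. by rewrite scoefM big_ord1 /= mul0r. Qed.

Lemma sconst_is_zmod_morphism : zmod_morphism (@sconst R).
Proof.
move=> a b; apply: seriesP => n; rewrite scoefD scoefN /=.
by case: ifP => // _; rewrite subr0.
Qed.

Lemma sconst_is_monoid_morphism : monoid_morphism (@sconst R).
Proof.
split=> // a b; apply: seriesP => n; rewrite scoef_sconstM /=.
by case: ifP => // _; rewrite mulr0.
Qed.

HB.instance Definition _ :=
  GRing.isZmodMorphism.Build R (series R) (@sconst R) sconst_is_zmod_morphism.
HB.instance Definition _ :=
  GRing.isMonoidMorphism.Build R (series R) (@sconst R) sconst_is_monoid_morphism.

End SeriesTheory.

Section SeriesMap.
Variables (A B : comNzRingType) (h : {rmorphism A -> B}).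

Definition series_map (f : series A) : series B := Series (fun n => h (scoef f n)).

Lemma series_map_is_zmod_morphism : zmod_morphism series_map.
Proof. by move=> f g; apply: seriesP => n; rewrite /= rmorphB. Qed.

Lemma series_map_is_monoid_morphism : monoid_morphism series_map.
Proof.
split=> [|f g]; apply: seriesP => n /=.
  by rewrite -[LHS]/(h _) [in LHS]fun_if rmorph1 rmorph0.
by rewrite rmorph_sum; apply: eq_bigr => i _; rewrite rmorphM.
Qed.

HB.instance Definition _ :=
  GRing.isZmodMorphism.Build (series A) (series B) series_map series_map_is_zmod_morphism.
HB.instance Definition _ :=
  GRing.isMonoidMorphism.Build (series A) (series B) series_map
    series_map_is_monoid_morphism.

Lemma series_map_inj : injective h -> injective series_map.
Proof. by move=> hI f g /series_eqP fg; apply: seriesP => n; apply/hI/fg. Qed.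

Lemma series_map_const c : series_map (sconst c) = sconst (h c).
Proof. by apply: seriesP => n /=; case: ifP => // _; rewrite rmorph0. Qed.

Lemma series_map_X : series_map (sX A) = sX B.
Proof. by apply: seriesP => n /=; rewrite rmorph_nat. Qed.

End SeriesMap.

Section SeriesDomain.
Variable R : idomainType.
Implicit Types f g : series R.

(** An [idomainType] carries an inverse operation; here it is obtained by choice, and the fraction
    field of [series R] is built on this structure. *)
Definition sunit : pred (series R) := fun f => `[< exists g, g * f = 1 >].

Definition sinv f : series R :=
  if pselect (exists g, g * f = 1) is left ex then projT1 (cid ex) else f.

Lemma sinvV : {in sunit, left_inverse 1 sinv *%R}.
Proof.
move=> f /asboolP ex; rewrite /sinv; case: pselect => // ex'.
exact: (projT2 (cid ex')).
Qed.

Lemma sunitP f g : g * f = 1 -> sunit f.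
Proof. by move=> gf; apply/asboolP; exists g. Qed.

Lemma sinv_out : {in [predC sunit], sinv =1 id}.
Proof. by move=> f /asboolP nex; rewrite /sinv; case: pselect. Qed.

HB.instance Definition _ :=
  GRing.ComNzRing_hasMulInverse.Build (series R) sinvV sunitP sinv_out.

Lemma series_lead f : f != 0 ->
  exists n, scoef f n != 0 /\ forall i, (i < n)%N -> scoef f i = 0.
Proof.
move=> f0; have ex : exists n, scoef f n != 0.
  apply: contrapT => nex; move/eqP: f0; apply; apply: seriesP => n.
  by rewrite scoef0; apply/eqP/negPn/negP => fn; apply: nex; exists n.
case: (ex_minnP ex) => n fn nmin; exists n; split=> // i.
by apply: contraTeq => /nmin; rewrite -leqNgt.
Qed.

(** At the sum of the two orders, the coefficient of the product is the product of the lowest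
    coefficients. *)
Lemma series_integral : GRing.integral_domain_axiom (series R).
Proof.
move=> f g fg0; apply/norP => -[/series_lead[m [fm ltm]] /series_lead[n [gn ltn]]].
have := congr1 (fun u => scoef u (m + n)) fg0; rewrite scoef0 scoefM.
have mlt : (m < (m + n).+1)%N by rewrite ltnS leq_addr.
rewrite (bigD1 (Ordinal mlt)) //= addKn big1 => [/eqP|i].
  by rewrite addr0 mulf_eq0 (negPf fm) (negPf gn).
rewrite -val_eqE /= neq_ltn => /orP[im|mi]; first by rewrite ltm // mul0r.
rewrite [X in _ * X]ltn ?mulr0 // ltn_subLR ?ltn_add2r //.
by rewrite -ltnS.
Qed.

HB.instance Definition _ :=
  GRing.ComUnitRing_isIntegral.Build (series R) series_integral.

End SeriesDomain.

Section PolySeries.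
Variable k : fieldType.
Local Notation R := (series k).
Local Notation W := (series {poly k}).

(* [k[[t]][X]] inside [k[X][[t]]] *)
Definition swap (p : {poly R}) : W := Series (fun n => map_poly (fun c => scoef c n) p).

Lemma coef_swap p n i : (scoef (swap p) n)`_i = scoef p`_i n.
Proof. by rewrite coef_map_id0 // scoef0. Qed.

Lemma size_swap p n : (size (scoef (swap p) n) <= size p)%N.
Proof. exact: size_poly. Qed.

Lemma swap_is_zmod_morphism : zmod_morphism swap.
Proof.
move=> p q; apply: seriesP => n; apply/polyP => i.
by rewrite scoefD scoefN coefB !coef_swap coefB.
Qed.

Lemma swap_is_monoid_morphism : monoid_morphism swap.
Proof.
split=> [|p q]; apply: seriesP => n; apply/polyP => i.
  rewrite coef_swap scoef1 coef1; case: i => [|i].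
    by rewrite scoef1; case: (n == 0%N); rewrite ?coef1 ?coef0.
  by rewrite scoef0; case: (n == 0%N); rewrite ?coef1 ?coef0.
rewrite coef_swap coefM scoef_sum scoefM coef_sum.
under eq_bigr do rewrite scoefM.
rewrite exchange_big; apply: eq_bigr => l _; rewrite coefM.
by apply: eq_bigr => j _; rewrite !coef_swap.
Qed.

HB.instance Definition _ :=
  GRing.isZmodMorphism.Build {poly R} W swap swap_is_zmod_morphism.
HB.instance Definition _ :=
  GRing.isMonoidMorphism.Build {poly R} W swap swap_is_monoid_morphism.

Lemma swap_inj : injective swap.
Proof.
move=> p q /series_eqP pq; apply/polyP => i; apply: seriesP => n.
by rewrite -!coef_swap pq.
Qed.

Lemma swap_bounded (v : W) s : (forall n, (size (scoef v n) <= s)%N) ->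
  exists2 p, swap p = v & (size p <= s)%N.
Proof.
move=> sv; exists (\poly_(i < s) Series (fun n => (scoef v n)`_i)); last exact: size_poly.
apply: seriesP => n; apply/polyP => i; rewrite coef_swap coef_poly.
by case: ltnP => // si; rewrite scoef0 nth_default // (leq_trans (sv n)).
Qed.

(** If [v] vanishes below index [n], the coefficient of t^n in [P * v] is ['X^M] times that of [v],
    and its size is at most [M] only if it is zero. *)
Lemma small_multiple_eq0 M (P v : W) : scoef P 0 = 'X^M ->
  (forall n, (size (scoef (P * v)%R n) <= M)%N) -> v = 0.
Proof.
move=> P0 sPv; apply: seriesP => n; rewrite scoef0.
elim/ltn_ind: n => n IHn; have := sPv n.
rewrite scoefM big_ord_recl /= subn0 P0 big1 ?addr0 => [|i _]; last first.
  by rewrite IHn ?mulr0 // /bump /= ltn_subrL; case: (n) i => [[]|].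
rewrite mulrC; have [->//|vn0] := eqVneq (scoef v n) 0.
rewrite size_mulXn // -{2}[M]addn0 leq_add2l leqn0 size_poly_eq0.
by move/eqP.
Qed.

(** Divide [Q] by the monic [P] in k[[t]][X]. The difference of [v] and the quotient, multiplied by
    [P], is the remainder, which is too small in X unless that difference is zero. *)
Lemma swap_divisible M (P Q : {poly R}) (v : W) :
  P \is monic -> size P = M.+1 -> scoef (swap P) 0 = 'X^M ->
  swap P * v = swap Q -> exists G, swap G = v.
Proof.
move=> Pmon sP P0 PvQ; exists (Pdiv.Ring.rdivp Q P).
apply/esym/eqP; rewrite -subr_eq0; apply/eqP.
apply: (small_multiple_eq0 P0) => n.
rewrite mulrBr PvQ {1}[Q](Pdiv.RingMonic.rdivp_eq Pmon) mulrC -rmorphM -rmorphB /=.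
rewrite [P * _]mulrC addrC addKr; apply: leq_trans (size_swap _ _) _.
by rewrite -ltnS -sP Pdiv.Ring.ltn_rmodpN0 // monic_neq0.
Qed.

End PolySeries.

(** Recursion on all earlier terms: [l n] lists the first [n] terms, and [step] sees [x0] from index
    [n] on. *)
Lemma course_of_values (T : Type) (x0 : T) (step : nat -> (nat -> T) -> T) :
  exists s : nat -> T, forall n, s n = step n (fun i => if (i < n)%N then s i else x0).
Proof.
pose fix l n := if n is n'.+1 then rcons (l n') (step n' (nth x0 (l n'))) else [::].
have sl n : size (l n) = n by elim: n => //= n IH; rewrite size_rcons IH.
have nl n i : (i < n)%N -> nth x0 (l n) i = nth x0 (l i.+1) i.
  elim: n => // n IHn; rewrite ltnS leq_eqVlt => /predU1P[->//|lt_in].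
  by rewrite /= !nth_rcons !sl lt_in ltnn eqxx IHn //= nth_rcons sl ltnn eqxx.
exists (fun n => nth x0 (l n.+1) n) => n.
rewrite /= nth_rcons sl ltnn eqxx; congr step; apply: funext => i.
by case: ltnP => [/nl//|ni]; rewrite nth_default // sl.
Qed.

Section Weierstrass.
Variable k : fieldType.

(* The factors are built coefficient by coefficient: modulo the coefficients
   already known, the coefficient of t^n in P * U is [P_n + 'X^M * U_n], so P_n
   and U_n are read off by Euclidean division by ['X^M]. *)
Lemma weierstrass_preparation M (D : {poly series k}) :
  scoef (swap D) 0 = 'X^M ->
  exists P U : {poly series k}, [/\ D = P * U, P \is monic, size P = M.+1,
    scoef (swap P) 0 = 'X^M & scoef (swap U) 0 = 1].
Proof.
move=> D0; pose d := scoef (swap D).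
pose rest n (s : nat -> {poly k} * {poly k}) :=
  d n - \sum_(i < n.+1 | (0 < i < n)%N) (s i).1 * (s (n - i)%N).2.
have [s sE] := course_of_values ('X^M, 1 : {poly k}) (fun n s =>
  if n is 0%N then ('X^M, 1) else (take_poly M (rest n s), drop_poly M (rest n s))).
(* Only indices strictly between 0 and [n] are read, so the default pair beyond [n] does not
   enter. *)
have restE n : rest n (fun i => if (i < n)%N then s i else ('X^M, 1)) = rest n s.
  congr (_ - _); apply: eq_bigr => i /andP[i_gt0 i_ltn].
  by rewrite i_ltn ltn_subrL i_gt0 (leq_trans _ i_ltn).
have s0 : s 0%N = ('X^M, 1) by rewrite sE.
have sS n : s n.+1 = (take_poly M (rest n.+1 s), drop_poly M (rest n.+1 s)).
  by rewrite sE restE.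
have sizeP n : (size (s n).1 <= M.+1)%N.
  by case: n => [|n]; rewrite ?s0 ?sS ?size_polyXn // (leq_trans (size_take_poly _ _)).
have D_neq0 : D != 0.
  apply: contra_eq_neq D0 => ->; rewrite rmorph0 scoef0 eq_sym.
  by rewrite -size_poly_gt0 size_polyXn.
have sizeD_gt0 : (0 < size D)%N by rewrite size_poly_gt0.
(* The products in [rest] have size at most [M + size D], and dropping [M] coefficients leaves
   [size D]. This bound is uniform in [n], hence U is polynomial in X. *)
have sizeU n : (size (s n).2 <= size D)%N.
  elim/ltn_ind: n => -[|n] IHn; first by rewrite s0 size_poly1.
  rewrite sS size_drop_poly leq_subLR /rest.
  apply: leq_trans (size_polyD _ _) _; rewrite geq_max size_polyN.
  rewrite (leq_trans (size_swap _ _)) ?leq_addl //=.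
  apply: leq_trans (size_sum _ _ _) _; apply/bigmax_leqP => i /andP[i_gt0 i_ltn].
  apply: leq_trans (size_polyMleq _ _) _.
  rewrite -subn1 leq_subLR addnA add1n leq_add ?sizeP // IHn //.
  by rewrite ltn_subrL i_gt0.
have [P PE sP] := swap_bounded (v := Series (fun n => (s n).1)) sizeP.
have [U UE _] := swap_bounded (v := Series (fun n => (s n).2)) sizeU.
(* The coefficient of t^0 in P is ['X^M] and all later ones have size at most [M], so the
   coefficient at [M] is the series 1. *)
have coefPM : P`_M = 1.
  apply: seriesP => n; rewrite -coef_swap PE scoef1 /=.
  case: n => [|n]; first by rewrite s0 coefXn eqxx.
  by rewrite sS coef_take_poly ltnn.
have sizeP_eq : size P = M.+1.
  apply/eqP; rewrite eqn_leq sP ltnNge; apply/negP => sPM.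
  by have := oner_neq0 (series k); rewrite -coefPM nth_default ?eqxx.
exists P, U; split=> //; last 2 first.
- by rewrite PE /= s0.
- by rewrite UE /= s0.
- apply: swap_inj; rewrite rmorphM /= PE UE; apply: seriesP => n; rewrite scoefM /=.
  case: n => [|n]; first by rewrite big_ord1 s0 mulr1.
  rewrite big_ord_recl big_ord_recr /= subn0 subnn s0 mulr1 sS /= mulrC.
  have -> : \sum_(i < n) (s (bump 0 i)).1 * (s (n.+1 - bump 0 i)%N).2
      = d n.+1 - rest n.+1 s.
    rewrite /rest opprB addrCA subrr addr0 [RHS]big_mkcond big_ord_recl big_ord_recr /=.
    rewrite ltnn addr0 add0r; apply: eq_bigr => i _.
    by rewrite /bump /= add1n ltnS ltn_ord.
  by rewrite addrCA [_ * 'X^M + _]addrC poly_take_drop subrK.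
- by rewrite monicE lead_coefE sizeP_eq coefPM.
Qed.

End Weierstrass.

(** * The kernel method *)

Section ConstantTerm.
Variable R : comNzRingType.

(** Setting t = 0. As a ring morphism it commutes with determinants. *)
Definition const_term (f : series R) := scoef f 0.

Lemma const_term_is_zmod_morphism : zmod_morphism const_term.
Proof. by []. Qed.

Lemma const_term_is_monoid_morphism : monoid_morphism const_term.
Proof. by split=> // f g; rewrite /const_term scoefM big_ord1. Qed.

HB.instance Definition _ :=
  GRing.isZmodMorphism.Build (series R) R const_term const_term_is_zmod_morphism.
HB.instance Definition _ :=
  GRing.isMonoidMorphism.Build (series R) R const_term const_term_is_monoid_morphism.

Lemma scoefM_low (f g : series R) n : (forall i, (i < n)%N -> scoef g i = 0) ->
  scoef (f * g) n = scoef f 0 * scoef g n.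
Proof.
move=> g_low; rewrite scoefM big_ord_recl /= subn0 big1 ?addr0 // => i _.
by rewrite g_low ?mulr0 // ltn_subrL; case: (n) i => [[]|].
Qed.

End ConstantTerm.

Lemma map_poly_lift (A B : nzRingType) (phi : {rmorphism A -> B})
    (p : {poly B}) : (forall i, exists a, phi a = p`_i) -> exists q, map_poly phi q = p.
Proof.
move=> /choice[c cE]; exists (\poly_(i < size p) c i); apply/polyP => i.
rewrite coef_map coef_poly; case: ltnP => [_|/(nth_default 0)->]; first exact: cE.
exact: rmorph0.
Qed.

Lemma fraction_numden (R : idomainType) (u : {fraction R}) :
  exists2 c : R, c != 0 & exists a : R, tofrac c * u = tofrac a.
Proof.
elim/quotW: u => x; exists (\d_x); first exact: denom_ratioP.
exists (\n_x); rewrite -[LHS]/(FracField.mul _ _).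
apply/eqP; rewrite !piE /FracField.mulf -[X in is_true X]/(equivf _ _).
by rewrite FracField.equivfE !numden_Ratio ?mul1r ?oner_eq0 ?denom_ratioP // mulr1 mulrC.
Qed.

(** Carries a solution over the fraction field back to polynomials over [R], where for [R] = k[[t]]
    the coefficients in t can be compared. *)
Lemma common_denominator (R : idomainType) (I : finType) (w : I -> {poly {fraction R}}) :
  exists2 c : R, c != 0 &
    forall i, exists r : {poly R}, map_poly (@tofrac R) r = (tofrac c)%:P * w i.
Proof.
have one (p : {poly {fraction R}}) :
      exists c : R, c != 0 /\ exists r : {poly R}, map_poly (@tofrac R) r = (tofrac c)%:P * p.
  elim/poly_ind: p => [|p u [c [c0 [r rE]]]].
    by exists 1; split; rewrite ?oner_neq0 //; exists 0; rewrite rmorph0 mulr0.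
  have [d d0 [a aE]] := fraction_numden u.
  exists (c * d); split; first by rewrite mulf_neq0.
  exists (d%:P * r * 'X + (c * a)%:P).
  rewrite rmorphD !rmorphM /= map_polyX !map_polyC /= rE -aE !rmorphM /=.
  move: (tofrac c)%:P (tofrac d)%:P u%:P => c' d' u'.
  by rewrite mulrDr !mulrA [d' * c']mulrC.
have [d dP] := choice (fun i => one (w i)).
exists (\prod_i d i); first by apply/prodf_neq0 => i _; case: (dP i).
move=> i; have [_ [r rE]] := dP i; exists ((\prod_(j | j != i) d j)%:P * r).
have -> : \prod_j d j = \prod_(j | j != i) d j * d i by rewrite (bigD1 i) //= mulrC.
by rewrite rmorphM /= map_polyC /= rE rmorphM rmorphM /=; exact: mulrA.
Qed.

Section Kernel.
Variables (k k0 : fieldType) (phi : {rmorphism k0 -> {fraction (series k)}}).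
Local Notation R := (series k).
Local Notation W := (series {poly k}).
Local Notation tau := (@tofrac R).
(** The field [k0] stands for k(t): all that matters is that its image contains the constants and
    t. *)
Hypothesis phi_const : forall c : k, exists a, phi a = tau (sconst c).
Hypothesis phi_X : exists a, phi a = tau (sX k).

(** The entries of [A] carry the shift by X^b. Dropping the lowest [b] coefficients undoes the shift
    and discards what has left the half-line. *)
Variables (N b : nat) (A : 'M[{poly k}]_N) (f : nat -> 'cV[{poly k}]_N).
Hypothesis f_rec : forall n, f n.+1 = map_mx (drop_poly b) (A *m f n).

Local Notation cst := (map_poly (@sconst k)).

Lemma swap_cst p : swap (cst p) = sconst p.
Proof.
apply: seriesP => n; apply/polyP => i; rewrite coef_swap coef_map /=.
by case: ifP => // _; rewrite coef0.
Qed.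

Definition kernel_mx : 'M[{poly R}]_N := ('X^b)%:M - (sX k)%:P *: map_mx cst A.

Let F : 'cV[W]_N := \col_i Series (fun n => f n i 0).

Lemma swap_polyCX : swap (sX k)%:P = sX {poly k}.
Proof.
apply: seriesP => n; apply/polyP => i; rewrite coef_swap coefC /=.
by case: i => [|i] /=; case: (n == 1%N); rewrite ?coef1 ?coef0 ?if_same.
Qed.

Lemma swap_kernel_mx :
  map_mx (@swap k) kernel_mx = (sconst 'X^b)%:M - sX _ *: map_mx (@sconst _) A.
Proof.
apply/matrixP => i j; rewrite !mxE rmorphB rmorphMn rmorphM /= swap_polyCX swap_cst.
by rewrite -(swap_cst 'X^b) map_polyXn.
Qed.

Lemma const_term_kernel_mx : map_mx (@const_term _ \o @swap k) kernel_mx = ('X^b)%:M.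
Proof.
rewrite map_mx_comp swap_kernel_mx; apply/matrixP => i j; rewrite !mxE.
by rewrite rmorphB rmorphMn rmorphM /= mul0r subr0.
Qed.

(** [H] collects the low parts that [drop_poly b] removes from [A *m f n]. Their sizes are at most
    [b] for every [n], so [H] is polynomial in X. *)
Lemma kernel_equation : exists2 H : 'cV[{poly R}]_N,
  forall i, (size (H i 0%R) <= b)%N &
  map_mx (@swap k) kernel_mx *m F
    = map_mx (@swap k) ('X^b *: map_mx cst (f 0%N) - H).
Proof.
(* The part lost in the step from n to n + 1 is placed at t^(n+1), in accordance with the factor t
   in [t A]. *)
pose h i := Series (fun n => if n is n'.+1 then take_poly b ((A *m f n') i 0) else 0).
have sh i n : (size (scoef (h i) n) <= b)%N.
  by case: n => [|n]; rewrite ?size_poly0 //= size_take_poly.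
have [H HE] := choice (fun i => let: ex_intro2 p pE sp := swap_bounded (sh i) in
   ex_intro _ p (conj pE sp)).
exists (\col_i H i) => [i|]; first by rewrite mxE; case: (HE i).
rewrite swap_kernel_mx mulmxBl mul_scalar_mx -scalemxAl.
apply/colP => i; rewrite !mxE rmorphB rmorphM /= (proj1 (HE i)).
rewrite -[in swap 'X^b](map_polyXn (@sconst k)) !swap_cst.
apply: seriesP => n; rewrite !(scoefD, scoefN).
have FE j : F j 0 = Series (fun n => f n j 0) by rewrite mxE.
rewrite !scoef_sconstM; case: n => [|n]; first by rewrite scoef_sXM0 !subr0.
rewrite scoef_sXM scoef_sum /= f_rec mulr0 add0r !mxE.
have -> : \sum_j scoef (map_mx (@sconst _) A i j * F j 0) n = (A *m f n) i 0.
  by rewrite mxE; apply: eq_bigr => j _; rewrite mxE FE scoef_sconstM.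
rewrite -[in X in _ - X](poly_take_drop b ((A *m f n) i 0)) mxE.
by rewrite mulrC opprD addrCA subrr addr0.
Qed.

(** Multiplication by the adjugate gives P (U F) = Q with Q in k[[t]][X], so [swap_divisible] makes
    U F polynomial in X. *)
Lemma kernel_rational : exists (P U : {poly R}) (G H : 'cV[{poly R}]_N),
  [/\ \det kernel_mx = P * U, P \is monic, scoef (swap U) 0 = 1,
      forall i, (size (H i 0%R) <= b)%N &
      U *: ('X^b *: map_mx cst (f 0%N) - H) = kernel_mx *m G /\
      forall i, swap (G i 0) = swap U * F i 0].
Proof.
have [H sH HE] := kernel_equation.
have D0 : scoef (swap (\det kernel_mx)) 0 = 'X^(b * N).
  rewrite -[LHS]/((@const_term _ \o @swap k) _) -det_map_mx const_term_kernel_mx.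
  by rewrite det_scalar exprM.
have [P [U [DE Pmon sP P0 U0]]] := weierstrass_preparation D0.
pose Q := \adj kernel_mx *m ('X^b *: map_mx cst (f 0%N) - H).
have QE i : swap P * (swap U * F i 0) = swap (Q i 0).
  have -> : swap (Q i 0) = (map_mx (@swap k) Q) i 0 by rewrite [RHS]mxE.
  rewrite map_mxM -HE map_mx_adj mulmxA mul_adj_mx mul_scalar_mx [RHS]mxE det_map_mx DE.
  by rewrite rmorphM mulrA.
have [G GE] := choice (fun i => swap_divisible Pmon sP P0 (QE i)).
exists P, U, (\col_i G i), H; split=> //; split=> [|i]; last by rewrite mxE GE.
(* The system is verified after the injective [swap], where G may be replaced by U F and the kernel
   equation applies. *)
suff /matrixP EQ : map_mx (@swap k) (U *: ('X^b *: map_mx cst (f 0%N) - H))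
    = map_mx (@swap k) (kernel_mx *m \col_i G i).
  by apply/matrixP => i j; apply: swap_inj; have := EQ i j; rewrite !mxE.
rewrite map_mxM map_mxZ -HE scalemxAr; congr (_ *m _).
by apply/colP => i; rewrite [LHS]mxE [RHS]mxE [X in _ = swap X]mxE GE.
Qed.

(** At the lowest remaining power of t the equation reads H_n + X^b G_n = 0. As H_n has size at most
    [b], the two terms occupy disjoint degrees and both vanish. *)
Lemma kernel_system_injective (U : {poly R}) (G H : 'cV[{poly R}]_N) :
  scoef (swap U) 0 = 1 -> (forall i, (size (H i 0%R) <= b)%N) ->
  U *: H + kernel_mx *m G = 0 -> H = 0 /\ G = 0.
Proof.
move=> U0 sH /(congr1 (map_mx (@swap k))).
rewrite map_mxD map_mxZ map_mxM map_mx0 => UHBG.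
have HG0 n : forall i, scoef (swap (H i 0)) n = 0 /\ scoef (swap (G i 0)) n = 0.
  elim/ltn_ind: n => n IHn i.
  have := congr1 (fun v : 'cV_N => scoef (v i 0) n) UHBG.
  rewrite !mxE scoefD scoef0 scoef_sum scoefM_low; last first.
    by move=> l ln; case: (IHn l ln i).
  rewrite U0 mul1r.
  have -> : \sum_j scoef (map_mx (@swap k) kernel_mx i j * map_mx (@swap k) G j 0) n
      = scoef (swap (G i 0)) n * 'X^b.
    transitivity (\sum_j (('X^b)%:M : 'M_N) i j * scoef (swap (G j 0)) n).
      apply: eq_bigr => j _; rewrite scoefM_low => [|l ln]; last first.
        by rewrite mxE; case: (IHn l ln j).
      by rewrite -const_term_kernel_mx !mxE.
    rewrite (bigD1 i) //= big1 ?addr0 ?mxE ?eqxx ?mulr1n 1?mulrC // => j ji.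
    by rewrite mxE eq_sym (negPf ji) mul0r.
  have sHn : (size (scoef (swap (H i 0%R)) n) <= b)%N.
    exact: leq_trans (size_swap _ _) (sH i).
  move=> HG; split.
    by rewrite -(take_polyDMXn (scoef (swap (G i 0)) n) sHn) HG take_poly0r.
  by rewrite -(drop_polyDMXn (scoef (swap (G i 0)) n) sHn) HG drop_poly0r.
by split; apply/colP => i; rewrite mxE; apply: swap_inj; apply: seriesP => n;
  rewrite rmorph0 scoef0; case: (HG0 n i).
Qed.

Lemma kernel_algebraic (x : k) (i : 'I_N) :
  algebraicOver phi (tau (Series (fun n => (f n i 0).[x]))).
Proof.
have [P [U [G [H [DE Pmon U0 sH [sysE GE]]]]]] := kernel_rational.
have tau_inj : injective tau by move=> u v /eqP; rewrite tofrac_eq => /eqP.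
have cst_lift p : exists q, map_poly phi q = map_poly tau (cst p).
  by apply: map_poly_lift => l; have [a aE] := phi_const p`_l; exists a; rewrite !coef_map.
have kernel_lift j l : exists q, map_poly phi q = map_poly tau (kernel_mx j l).
  have [t tE] := phi_X; have [q qE] := cst_lift (A j l).
  exists ('X^b *+ (j == l) - t%:P * q); rewrite !mxE !rmorphB !rmorphMn !rmorphM /=.
  by rewrite !map_polyXn !map_polyC /= tE qE.
have [D DkE] : exists D, map_poly phi D = map_poly tau (\det kernel_mx).
  have /choice[B BE] := fun jl => kernel_lift jl.1 jl.2.
  exists (\det (\matrix_(j, l) B (j, l))); rewrite -!det_map_mx; congr (\det _).
  apply/matrixP => j l; transitivity (map_poly phi (B (j, l))); first by rewrite !mxE.
  by rewrite BE [RHS]mxE.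
have U_neq0 : U != 0.
  by apply: contra_eq_neq U0 => ->; rewrite rmorph0 scoef0 eq_sym oner_neq0.
have PU_neq0 : map_poly tau (P * U) != 0.
  rewrite -(rmorph0 (map_poly tau)) (inj_eq (map_inj_poly tau_inj _)) ?rmorph0 //.
  by apply: mulf_neq0 => //; apply: monic_neq0.
have D_neq0 : D != 0 by rewrite -(map_poly_eq0 phi) DkE DE.
have P_alg : forall l, algebraicOver phi (map_poly tau P)`_l.
  apply: (algebraic_coef_monic_factor D_neq0); first exact: monic_map.
  by rewrite DkE DE rmorphM dvdp_mulIl.
have [L [psi psiP]] := algebraic_subfield phi.
have psi_phi a : exists l, psi l = phi a by apply/psiP; apply: algebraic_id.
have phi_psi (p : {poly {fraction R}}) :
    (exists q, map_poly phi q = p) -> exists q, map_poly psi q = p.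
  by case=> q <-; apply: map_poly_lift => l; rewrite coef_map; apply: psi_phi.
have [P' P'E] : exists q, map_poly psi q = map_poly tau P.
  by apply: map_poly_lift => l; apply/psiP.
have [D' D'E] := phi_psi _ (ex_intro _ D DkE).
(* U is the exact quotient of [\det kernel_mx] by P, so its coefficients lie in [L] as well. *)
have [U' U'E] : exists q, map_poly psi q = map_poly tau U.
  exists (D' %/ P'); rewrite map_divp D'E P'E DE rmorphM mulrC mulpK //.
  by rewrite monic_neq0 // monic_map.
have /choice[B BE] := fun jl => phi_psi _ (kernel_lift jl.1 jl.2).
have /choice[f0 f0E] := fun j => phi_psi _ (cst_lift (f 0%N j 0)).
pose sG := \max_j size (G j 0%R).
(* In the system U H + B G = U X^b f_0 the left summand of the index type stands for H, the right
   one for G. *)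
pose s (z : 'I_N + 'I_N) := if z is inl _ then b else sG.
pose a (j : 'I_N) (z : 'I_N + 'I_N) :=
  match z with inl l => if l == j then U' else 0 | inr l => B (j, l) end.
pose v (z : 'I_N + 'I_N) : {poly {fraction R}} :=
  match z with inl l => map_poly tau (H l 0) | inr l => map_poly tau (G l 0) end.
have sumE (w : 'I_N + 'I_N -> {poly {fraction R}}) j :
    \sum_z map_poly psi (a j z) * w z = map_poly tau U * w (inl j)
      + \sum_l map_poly tau (kernel_mx j l) * w (inr l).
  rewrite big_sumType /= (bigD1 j) //= eqxx U'E big1 ?addr0 => [|l lj].
    by congr (_ + _); apply: eq_bigr => l _; rewrite BE.
  by rewrite (negPf lj) rmorph0 mul0r.
have sizeE (p : {poly R}) : size (map_poly tau p) = size p.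
  by apply: size_map_inj_poly => //; rewrite rmorph0.
have v_alg z : exists l, map_poly psi l = v z.
  apply: (poly_system_descent (s := s) (a := a) (c := fun j => U' * 'X^b * f0 j)).
  - case=> l /=; rewrite sizeE //; exact: (leq_bigmax l).
  - move=> j; rewrite sumE !rmorphM /= U'E map_polyXn f0E.
    have := congr1 (fun u : 'cV_N => map_poly tau (u j 0)) sysE.
    rewrite !mxE rmorphM rmorphB rmorphM /= map_polyXn mulrBr mulrA => /eqP.
    rewrite subr_eq => /eqP ->; rewrite addrC rmorph_sum; congr (_ + _).
    by apply: eq_bigr => l _; rewrite rmorphM.
  (* A homogeneous solution over the fraction field is multiplied by a common denominator, after
     which [kernel_system_injective] applies. *)
  move=> w sw weq; have [c c0 /choice[r rE]] := common_denominator w.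
  have c_neq0 : (tau c)%:P != 0 by rewrite polyC_eq0 tofrac_eq0.
  have sr y : (size (r y) <= s y)%N.
    by rewrite -sizeE rE mul_polyC (leq_trans (size_scale_leq _ _)).
  have [||rH rG] := @kernel_system_injective U (\col_j r (inr j)) (\col_j r (inl j)) U0.
  - by move=> j; rewrite mxE; apply: (sr (inl j)).
  - apply/colP => j; rewrite !mxE; apply: (map_inj_poly tau_inj); first exact: rmorph0.
    rewrite rmorph0 rmorphD rmorphM rmorph_sum /= rE.
    have := congr1 (fun u => (tau c)%:P * u) (weq j).
    rewrite sumE mulr0 mulrDr mulrCA => wj; apply: etrans wj; congr (_ + _).
    rewrite mulr_sumr; apply: eq_bigr => l _.
    by rewrite rmorphM /= [X in _ * map_poly tau X = _]mxE rE mulrCA.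
  have r0 y : r y = 0.
    case: y => j; [have := congr1 (fun u : 'cV_N => u j 0) rH
                  | have := congr1 (fun u : 'cV_N => u j 0) rG]; by rewrite !mxE.
  move=> y; apply/eqP; have /eqP := rE y.
  by rewrite r0 rmorph0 eq_sym mulf_eq0 (negPf c_neq0).
pose u := Series (fun n => (f n i 0).[x]).
have evalE p : series_map (horner_eval x) (swap p) = p.[sconst x].
  elim/poly_ind: p => [|p c IHp]; first by rewrite !rmorph0 horner0.
  rewrite hornerMXaddC -IHp !rmorphD !rmorphM /=; congr (_ * _ + _).
    rewrite -(map_polyX (@sconst k)) swap_cst series_map_const.
    by rewrite /= /horner_eval hornerX.
  apply: seriesP => n; rewrite -[LHS]/((scoef (swap c%:P) n).[x]).
  rewrite (_ : scoef (swap c%:P) n = (scoef c n)%:P) ?hornerC //.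
  by apply/polyP => l; rewrite coef_swap !coefC; case: eqP; rewrite ?scoef0.
have uE : U.[sconst x] * u = (G i 0).[sconst x].
  rewrite -!evalE GE rmorphM /=; congr (_ * _).
  by apply: seriesP => n; rewrite /= mxE.
(* The value of U at X = x has constant term 1 in t, so division by it is legitimate. *)
have Ux_neq0 : U.[sconst x] != 0.
  have : scoef U.[sconst x] 0 != 0.
    by rewrite -evalE -[scoef _ _]/((scoef (swap U) 0).[x]) U0 hornerC oner_neq0.
  by apply: contraNneq => ->; rewrite scoef0.
have [x' x'E] : exists x', psi x' = tau (sconst x).
  by have [y <-] := phi_const x; apply: psi_phi.
have [G' G'E] := v_alg (inr i).
apply/psiP; exists (G'.[x'] / U'.[x']); rewrite rmorphM fmorphV /=.
rewrite -!horner_map /= G'E U'E x'E /v !horner_map -uE rmorphM /= mulrAC.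
by rewrite mulfV ?mul1r // tofrac_eq0.
Qed.

End Kernel.

(** * Recursion for the walk polynomials *)

(** Checked monomial by monomial: in degree at most one a monomial is 1, giving 1 + 1 on both sides,
    or a single variable. *)
Lemma meval_affine (R : comNzRingType) n (p : {mpoly R[n]}) (u v : 'I_n -> R) :
  (msize p <= 2)%N ->
  p.@[fun a => u a + v a] + p.@[fun _ => 0] = p.@[u] + p.@[v].
Proof.
move=> sp; rewrite !mevalE -!big_split big_seq [RHS]big_seq /=.
apply: eq_bigr => mn /msize_mdeg_lt mp; rewrite -!mulrDr; congr (_ * _).
have : (mdeg mn <= 1)%N by rewrite -ltnS (leq_trans mp).
rewrite leq_eqVlt ltnS leqn0 => /orP[/mdeg1P[i /eqP ->]|]; last first.
  by rewrite mdeg_eq0 => /eqP ->; rewrite !big1 // => i _; rewrite mnm0E expr0.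
have prodU (w : 'I_n -> R) : \prod_j w j ^+ U_(i)%MM j = w i by exact: mmap1U.
by rewrite !prodU addr0.
Qed.

Lemma sum_rcons_tuple (V : nmodType) (T : finType) n (F : seq T -> V) :
  \sum_(s : n.+1.-tuple T) F s = \sum_(s : n.-tuple T) \sum_a F (rcons s a).
Proof.
rewrite pair_big /= (reindex (fun sa : n.-tuple T * T => [tuple of rcons sa.1 sa.2])) //=.
apply: onW_bij; apply: inj_card_bij => [[s a] [s' a'] /= /(congr1 val) /=|].
  by move/rcons_inj => -[] /val_inj -> ->.
by rewrite card_prod !card_tuple expnSr.
Qed.

Lemma mod_ord_eq m (hm : (0 < m)%N) a b :
  (a = b %[mod m])%Z -> mod_ord hm a = mod_ord hm b.
Proof. by move=> ab; apply: val_inj; rewrite /= ab. Qed.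

Lemma mod_ord_val m (hm : (0 < m)%N) a : (mod_ord hm a : nat)%:Z = (a %% m)%Z.
Proof. by rewrite /= gez0_abs // modz_ge0 // -lt0n. Qed.

Lemma forall_ord_recr n (P : pred nat) :
  [forall l : 'I_n.+1, P l] = [forall l : 'I_n, P l] && P n.
Proof.
apply/forallP/andP => [Pn | [/forallP Pn Pnn] l].
  by split; [apply/forallP => l; apply: (Pn (widen_ord (leqnSn n) l))
            | apply: (Pn ord_max)].
have := ltn_ord l; rewrite ltnS leq_eqVlt => /predU1P[->//|ln].
exact: (Pn (Ordinal ln)).
Qed.

Section WalkRecursion.
Context (e k : nat) (m : 'I_k -> nat) (hm : forall q, (0 < m q)%N).
Context (p : 'I_k -> {mpoly int[1 + e + 1]}).
Hypothesis hp : forall q, (msize (p q) <= 2)%N.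
Context (K : fieldType) (S : residue m -> {fset point e}).
Context (w : forall r : residue m, S r -> K).
Context (i0 : nat) (j0 : 'rV[int]_e).

Local Notation pos := (position i0 j0).
Local Notation rule := (rule_at hm p i0 j0).
Local Notation ratfun := {fraction {mpoly K[1 + e]}}.

(* The difference of the two values of p_q is its linear part at (a, 1), hence
   the increment of p_q along the step a. *)
Definition next_residue (r : residue m) (a : point e) : residue m :=
  [ffun q => mod_ord (hm q)
     ((r q : nat)%:Z + (p q).@[eval_vector a 1] - (p q).@[fun _ => 0])].

(** This makes the residue a finite state: its next value depends on the position and the time only
    through its present value. *)
Lemma residue_at_step z n a :
  residue_at hm p (z + a) n.+1 = next_residue (residue_at hm p z n) a.
Proof.
apply/ffunP => q; rewrite !ffunE; apply: mod_ord_eq; rewrite mod_ord_val.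
(* The argument after the step is the old one plus [eval_vector a 1], the 1 being the advance of the
   step counter. *)
have -> : (p q).@[eval_vector (z + a) n.+1]
    = (p q).@[eval_vector z n] + (p q).@[eval_vector a 1] - (p q).@[fun _ => 0].
  rewrite -meval_affine // addrK; apply: meval_eq => l; rewrite /eval_vector.
  rewrite -[l]splitK; case: (split l) => l'; last first.
    by rewrite /= !row_mxEr !mxE intS addrC.
  rewrite /= !row_mxEl -[l']splitK; case: (split l') => l''.
    by rewrite /= !row_mxEl !mxE.
  by rewrite /= !row_mxEr !mxE.
by apply/eqP; rewrite !eqz_modDr modz_mod.
Qed.

Lemma position_rcons s a l : (l <= size s)%N -> pos (rcons s a) l = pos s l.
Proof.
move=> ls; rewrite /position -cats1 take_cat.
move: ls; rewrite leq_eqVlt => /orP[/eqP ->|->//].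
by rewrite ltnn subnn take0 cats0 take_size.
Qed.

Lemma position_rcons_size s a : pos (rcons s a) (size s).+1 = pos s (size s) + a.
Proof.
by rewrite /position take_oversize ?size_rcons // take_size -cats1 big_cat big_seq1 addrA.
Qed.

Lemma rule_rcons s a l : (l <= size s)%N -> rule (rcons s a) l = rule s l.
Proof. by move=> ls; rewrite /rule_at position_rcons. Qed.

Lemma rule_rcons_size s a :
  rule (rcons s a) (size s).+1 = next_residue (rule s (size s)) a.
Proof. by rewrite /rule_at position_rcons_size residue_at_step. Qed.

Lemma is_walk_rcons s a : is_walk hm p S i0 j0 (rcons s a) =
  [&& is_walk hm p S i0 j0 s, a \in S (rule s (size s)) & 0 <= (pos s (size s) + a).1].
Proof.
pose t := rcons s a.
have stepE (l : 'I_(size s)) : (nth 0 t l \in S (rule t l)) = (nth 0 s l \in S (rule s l)).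
  by rewrite nth_rcons ltn_ord rule_rcons // ltnW.
have posE (l : 'I_(size s).+1) : (0 <= (pos t l).1) = (0 <= (pos s l).1).
  by rewrite position_rcons // -ltnS.
rewrite /is_walk -/t size_rcons.
rewrite (forall_ord_recr _ (fun l => nth 0 t l \in S (rule t l))).
rewrite (forall_ord_recr _ (fun l => 0 <= (pos t l).1)).
rewrite (eq_forallb stepE) (eq_forallb posE).
rewrite position_rcons_size rule_rcons // nth_rcons ltnn eqxx.
by rewrite -!andbA; congr andb; rewrite andbCA.
Qed.

Lemma walk_weight_rcons s a : walk_weight hm p w i0 j0 (rcons s a)
  = walk_weight hm p w i0 j0 s * step_weight w (rule s (size s)) a.
Proof.
rewrite /walk_weight size_rcons big_ord_recr /= rule_rcons // nth_rcons ltnn eqxx.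
congr (_ * _); apply: eq_bigr => l _.
by rewrite nth_rcons ltn_ord rule_rcons // ltnW.
Qed.

Lemma step_weight_out r a : a \notin S r -> step_weight w r a = 0.
Proof. by move=> aS; rewrite /step_weight insubN. Qed.

Lemma is_walk_ge0 s : is_walk hm p S i0 j0 s -> 0 <= (pos s (size s)).1.
Proof. by move=> /andP[_ /forallP/(_ ord_max)]. Qed.

Definition ymonomial (j : 'rV[int]_e) : ratfun := \prod_a vary K a ^ j 0 a.

Lemma ymonomialD j j' : ymonomial (j + j') = ymonomial j * ymonomial j'.
Proof.
rewrite -big_split; apply: eq_bigr => a _.
by rewrite mxE expfzDr // vary_neq0.
Qed.

Local Notation const := (fun c : K => tofrac (c%:MP : {mpoly K[1 + e]})).

(** The shift exponent b of the kernel equation: adding it to the first coordinate of any step gives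
    a nonnegative number. *)
Definition max_drop : nat := \max_(a : all_steps S) `|(val a).1|%N.

(** The entry at target [r'] and source [r] of the matrix [A], already shifted by X^b. The sum may
    run over all steps because [step_weight] is 0 outside [S r]. *)
Definition transition (r' r : residue m) : {poly ratfun} :=
  \sum_(a : all_steps S | next_residue r (val a) == r')
     (const (step_weight w r (val a)) * ymonomial (val a).2)
       *: 'X^(`|(max_drop%:Z + (val a).1)%R|%N).

Definition walk_poly (s : seq (point e)) : {poly ratfun} :=
  (const (walk_weight hm p w i0 j0 s) * ymonomial (pos s (size s)).2)
    *: 'X^(`|(pos s (size s)).1|%N).

(** The state [r] is the residue governing the step after the [n]-th; X marks the first coordinate,
    while y stays in the coefficients. *)
Definition state_poly (n : nat) (r : residue m) : {poly ratfun} :=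
  \sum_(s : n.-tuple (all_steps S)
        | is_walk hm p S i0 j0 (steps_of s) && (rule (steps_of s) n == r))
    walk_poly (steps_of s).

Lemma size_steps_of n (s : n.-tuple (all_steps S)) : size (steps_of s) = n.
Proof. by rewrite size_map size_tuple. Qed.

Lemma drop_polyXn (R : comNzRingType) b n :
  drop_poly b ('X^n : {poly R}) = if (b <= n)%N then 'X^(n - b) else 0.
Proof.
rewrite -['X^n]mul1r drop_polyMXn; case: leqP => bn.
  by rewrite (eqP bn) drop_poly0l mul1r.
by rewrite drop_poly_eq0 ?mul0r // size_poly1 subn_gt0.
Qed.

(** Split off the last step u: X^(b+u) X^i loses its factor X^b under [drop_poly], and becomes 0
    exactly when i + u is negative, which is the half-space condition. *)
Lemma state_poly_rec n r' :
  state_poly n.+1 r' = drop_poly max_drop (\sum_r transition r' r * state_poly n r).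
Proof.
pose mv s (a : point e) := (const (step_weight w (rule s n) a) * ymonomial a.2)
  *: 'X^(`|(max_drop%:Z + a.1)%R|%N) : {poly ratfun}.
have -> : \sum_r transition r' r * state_poly n r =
    \sum_(s : n.-tuple (all_steps S) | is_walk hm p S i0 j0 (steps_of s))
    \sum_(a : all_steps S | next_residue (rule (steps_of s) n) (val a) == r')
       mv (steps_of s) (val a) * walk_poly (steps_of s).
  rewrite (partition_big (fun s => rule (steps_of s) n) xpredT) //=.
  apply: eq_bigr => r _; rewrite /transition /state_poly big_distrlr /= exchange_big /=.
  by apply: eq_bigr => s /andP[_ /eqP sr]; rewrite /mv sr.
rewrite drop_poly_sum /state_poly big_mkcond.
rewrite (sum_rcons_tuple n (fun s : seq (all_steps S) => if is_walk hm p S i0 j0 (map val s)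
  && (rule (map val s) n.+1 == r') then walk_poly (map val s) else 0)).
rewrite [RHS]big_mkcond; apply: eq_bigr => s _.
under eq_bigr do rewrite map_rcons -/(steps_of s).
move: (steps_of s) (size_steps_of s) => t st.
have ruleS a : rule (rcons t a) n.+1 = next_residue (rule t n) a.
  by rewrite -st rule_rcons_size.
have posS a : pos (rcons t a) n.+1 = pos t n + a by rewrite -st position_rcons_size.
case: ifP => t_walk; last first.
  by rewrite big1 // => a _; rewrite is_walk_rcons t_walk.
rewrite drop_poly_sum [RHS]big_mkcond; apply: eq_bigr => a _.
rewrite is_walk_rcons t_walk andTb ruleS st.
case: (next_residue _ _ == r'); last by rewrite andbF.
rewrite andbT /mv /walk_poly size_rcons st posS walk_weight_rcons st.
rewrite -scalerAl -scalerAr scalerA drop_polyZ -exprD drop_polyXn.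
have [aSr|aSr] := boolP (val a \in S _); last first.
  by rewrite step_weight_out // !rmorph0 !mul0r scale0r.
rewrite andTb; have i_ge0 : 0 <= (pos t n).1 by rewrite -st is_walk_ge0.
have u_le : (`|(val a).1|%N <= max_drop)%N by apply: (leq_bigmax a).
(* Both numbers inside absolute values on the left are nonnegative, so the natural-number exponent
   agrees with the integer coordinate. *)
have [le_n val_n] : (max_drop <= `|(max_drop%:Z + (val a).1)%R| + `|(pos t n).1|)%N
    = (0 <= (pos t n).1 + (val a).1) /\
  (0 <= (pos t n).1 + (val a).1 ->
   (`|(max_drop%:Z + (val a).1)%R| + `|(pos t n).1| - max_drop)%N
    = `|((pos t n).1 + (val a).1)%R|%N).
  move: (pos t n).1 (val a).1 max_drop i_ge0 u_le => x y b; lia.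
rewrite le_n; case: ifP => pa_ge0; last by rewrite scaler0.
rewrite val_n // rmorphM tofracM ymonomialD; congr (_ *: _).
by rewrite mulrACA mulrC.
Qed.

(** Summing over the states forgets the residue and X = x restores the variable; the remaining work
    is to group walks by endpoint. *)
Lemma sum_state_poly n :
  \sum_r (state_poly n r).[varx K e]
    = laurent_val (scoef (walk_gf hm p w i0 j0) n).
Proof.
pose F (z : nat * 'rV[int]_e) : ratfun := varx K e ^+ z.1 * ymonomial z.2.
pose endpoint s : nat * 'rV[int]_e := (`|(pos s n).1|%N, (pos s n).2).
transitivity (\sum_(s : n.-tuple (all_steps S) | is_walk hm p S i0 j0 (steps_of s))
    const (walk_weight hm p w i0 j0 (steps_of s)) * F (endpoint (steps_of s))).
  rewrite (partition_big (fun s => rule (steps_of s) n) xpredT) //=.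
  apply: eq_bigr => r _; rewrite horner_sum; apply: eq_bigr => s _.
  by rewrite hornerZ hornerXn size_steps_of -mulrA [ymonomial _ * _]mulrC.
have walkE z : const (walk_sum hm p w i0 j0 z.1 z.2 n) * F z
    = \sum_(s : n.-tuple (all_steps S) | is_walk hm p S i0 j0 (steps_of s))
       if endpoint (steps_of s) == z
       then const (walk_weight hm p w i0 j0 (steps_of s)) * F z else 0.
  rewrite /walk_sum rmorph_sum rmorph_sum mulr_suml -big_mkcondr.
  apply: eq_bigl => s; case s_walk : (is_walk _ _ _ _ _ _) => //=.
  have := is_walk_ge0 s_walk; rewrite size_steps_of /endpoint => pos_ge0.
  case: z (pos _ _) pos_ge0 => i j [x y] /= x_ge0; rewrite !xpair_eqE.
  by congr andb; apply/eqP/eqP => [->|<-]; rewrite ?absz_nat ?gez0_abs.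
rewrite -[scoef _ _]/(\sum_(z <- endpoints hm p S i0 j0 n) _) -[laurent_val _]/(\val _).
rewrite rmorph_sum (eq_bigr _ (fun z _ => walkE z)).
rewrite exchange_big /=; apply: eq_bigr => s s_walk.
(* Each walk contributes to exactly one member of [endpoints], its own endpoint. *)
rewrite (bigD1_seq (endpoint (steps_of s))) /= ?fset_uniq //; last first.
  by apply/imfsetP; exists s.
by rewrite eqxx big1 ?addr0 // => z; rewrite eq_sym => /negPf ->.
Qed.

End WalkRecursion.

(** * Passing from the rational functions to the Laurent polynomials *)

(** The field is that of the quotients [ev a / ev b] in [E]. Multiplying an annihilating polynomial
    by the product of the denominators of its coefficients brings it back to [Z]. *)
Lemma fractions_subfield (Z : comNzRingType) (E : fieldType) (ev : {rmorphism Z -> E}) :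
  exists (k0 : fieldType) (phi : {rmorphism k0 -> E}),
    (forall a, exists l, phi l = ev a) /\
    (forall u, algebraicOver phi u -> algebraic_over ev u).
Proof.
pose S : {pred E} := fun u => `[< exists a b, ev b != 0 /\ u * ev b = ev a >].
have [|k0 [phi phiP]] := @divring_closed_subfield E S.
  split=> [|u v /asboolP[a [b [b0 ub]]] /asboolP[c [d [d0 vd]]]|
            u v /asboolP[a [b [b0 ub]]] /asboolP[c [d [d0 vd]]]]; apply/asboolP.
  - by exists 1, 1; rewrite mul1r rmorph1 oner_neq0.
  - exists (a * d - c * b), (b * d); rewrite !rmorphM mulf_neq0 //; split=> //.
    by rewrite rmorphB !rmorphM /= -ub -vd mulrBl mulrA [ev b * _]mulrC mulrA.
  (* The case [v = 0] is separate, since there the inverse is 0 by convention. *)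
  - have [->|v0] := eqVneq v 0; last first.
      exists (a * d), (b * c); rewrite !rmorphM -vd !mulf_neq0 //; split=> //.
      rewrite -ub [ev b * _]mulrCA [LHS]mulrA. by rewrite divfK // mulrA.
    by exists 0, 1; rewrite invr0 mulr0 mul0r rmorph0 rmorph1 oner_neq0.
exists k0, phi; split=> [a|u [P P0 Pu]].
  by apply/phiP/asboolP; exists a, 1; rewrite rmorph1 oner_neq0 mulr1.
have fracP i : exists ab : Z * Z, ev ab.2 != 0 /\ phi P`_i * ev ab.2 = ev ab.1.
  have /phiP/asboolP[a [b ab]] : exists l, phi l = phi P`_i by exists P`_i.
  by exists (a, b).
have [ab abP] := choice fracP.
pose b := \prod_(i < size P) (ab i).2.
have b0 : ev b != 0.
  by rewrite rmorph_prod; apply/prodf_neq0 => i _; case: (abP i).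
have [Q QE] : exists Q, map_poly ev Q = (ev b)%:P * map_poly phi P.
  apply: map_poly_lift => i; rewrite coefCM coef_map.
  case: (ltnP i (size P)) => iP; last first.
    by exists 0; rewrite nth_default // raddf0 mulr0 rmorph0.
  exists ((ab i).1 * \prod_(j < size P | j != Ordinal iP) (ab j).2).
  case: (abP i) => _ abi; rewrite rmorphM -abi /b [in RHS](bigD1 (Ordinal iP)) //= !rmorphM.
  by rewrite [RHS]mulrC mulrA.
exists Q; last by rewrite QE rootM Pu orbT.
apply: contraNneq P0 => Q0; move/eqP: QE.
by rewrite Q0 rmorph0 eq_sym mulf_eq0 polyC_eq0 (negPf b0) map_poly_eq0.
Qed.

Section SeriesOfPolynomials.
Variables (K : fieldType) (e : nat).
Local Notation ratfun := {fraction {mpoly K[1 + e]}}.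
Local Notation E := {fraction (series ratfun)}.
Local Notation Z := {mpoly K[1 + e + 1]}.

Lemma laurent_of_mpoly_is_zmod_morphism : zmod_morphism (@laurent_of_mpoly K e).
Proof. by move=> g h; apply: val_inj; rewrite /= rmorphB. Qed.

Lemma laurent_of_mpoly_is_monoid_morphism : monoid_morphism (@laurent_of_mpoly K e).
Proof. by split=> [|g h]; apply: val_inj; rewrite /= ?rmorph1 ?rmorphM. Qed.

HB.instance Definition _ := GRing.isZmodMorphism.Build {mpoly K[1 + e]} (laurent K e)
  (@laurent_of_mpoly K e) laurent_of_mpoly_is_zmod_morphism.
HB.instance Definition _ := GRing.isMonoidMorphism.Build {mpoly K[1 + e]} (laurent K e)
  (@laurent_of_mpoly K e) laurent_of_mpoly_is_monoid_morphism.

(** The same map as [series_of_mpoly], with the coefficient map written as a composite of morphisms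
    so that the ring morphism structure is inferred. *)
Definition series_of_mpoly_morphism : {rmorphism Z -> series (laurent K e)} :=
  mmap (@sconst _ \o @laurent_of_mpoly K e \o @mpolyC (1 + e) K)
       (fun a => match split a with
                 | inl b => sconst (laurent_of_mpoly 'X_b)
                 | inr _ => sX (laurent K e)
                 end).

Lemma series_of_mpolyE : series_of_mpoly (K := K) (e := e) = series_of_mpoly_morphism.
Proof. by []. Qed.

Definition laurent_series_val : {rmorphism series (laurent K e) -> series ratfun} :=
  series_map (\val : {rmorphism laurent K e -> ratfun}).

Lemma laurent_series_val_inj : injective laurent_series_val.
Proof. exact/series_map_inj/val_inj. Qed.

Lemma series_of_mpolyC (g : {mpoly K[1 + e]}) :
  exists h : Z, series_of_mpoly_morphism h = sconst (laurent_of_mpoly g).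
Proof.
elim/mpolyind: g => [|c mn g _ _ [h hE]]; first by exists 0; rewrite !rmorph0.
exists (c%:MP * \prod_i 'X_(lshift 1 i) ^+ mn i + h).
rewrite !rmorphD /= hE; congr (_ + _); rewrite -mul_mpolyC mpolyXE_id !rmorphM /=.
rewrite mmapC !rmorph_prod; congr (_ * _); apply: eq_bigr => i _; rewrite !rmorphXn /=.
by rewrite mmapX mmap1U -[lshift 1 i]/(unsplit (inl i)) unsplitK.
Qed.

Lemma series_of_mpolyX : exists h : Z, series_of_mpoly_morphism h = sX _.
Proof.
exists 'X_(rshift _ ord0); rewrite /= mmapX mmap1U.
by rewrite -[rshift _ _]/(unsplit (inr ord0)) unsplitK.
Qed.

End SeriesOfPolynomials.

Theorem theorem1 (d : nat) (hd : (1 <= d)%N)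
  (K : fieldType) (hK : [pchar K] =i pred0)
  (k : nat) (hk : (1 <= k)%N)
  (p : 'I_k -> {mpoly int[1 + d.-1 + 1]}) (hp : forall q, (msize (p q) <= 2)%N)
  (m : 'I_k -> nat) (hm : forall q, (0 < m q)%N)
  (S : residue m -> {fset point d.-1})
  (w : forall r : residue m, S r -> K)
  (i0 : nat) (j0 : 'rV[int]_(d.-1)) :
  algebraic_over (@series_of_mpoly K d.-1) (walk_gf hm p w i0 j0).
Proof.
move: d.-1 p hp S w j0 => e p hp S w j0.
pose lval := laurent_series_val K e; pose som := series_of_mpoly_morphism K e.
pose ev : {rmorphism {mpoly K[1 + e + 1]}
    -> {fraction (series {fraction {mpoly K[1 + e]}})}} :=
  @tofrac _ \o lval \o som.
have [k0 [phi [phi_ev phi_alg]]] := fractions_subfield ev.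
(* An algebraic equation in the fraction field of K(x, y)[[t]] descends to the Laurent series along
   the injections [tofrac] and [lval]. *)
suff /phi_alg[P P0 Pu] : algebraicOver phi (tofrac (lval (walk_gf hm p w i0 j0))).
  exists P => //; rewrite series_of_mpolyE -/som; move: Pu.
  rewrite map_poly_comp map_poly_comp /root !horner_map tofrac_eq0.
  by rewrite -(rmorph0 lval) (inj_eq (@laurent_series_val_inj K e)).
have phi_poly (g : {mpoly K[1 + e]}) : exists l, phi l = tofrac (sconst (tofrac g)).
  have [h hE] := series_of_mpolyC g; have [l lE] := phi_ev h.
  by exists l; rewrite lE /ev /= -/som hE /lval /= series_map_const.
(* The image of [k0] consists of fractions, so with the polynomials in x and y it contains all of
   K(x, y). *)
have phi_const (c : {fraction {mpoly K[1 + e]}}) : exists l, phi l = tofrac (sconst c).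
  have [b b0 [a abE]] := fraction_numden c.
  have [lb lbE] := phi_poly b; have [la laE] := phi_poly a.
  exists (la / lb); rewrite fmorph_div laE lbE -abE !rmorphM mulrAC.
  rewrite mulfV ?mul1r // tofrac_eq0 -(rmorph0 (@sconst _)).
  by apply: contraNneq b0 => /series_eqP/(_ 0%N) /=/eqP; rewrite tofrac_eq0.
have phi_X : exists l, phi l = tofrac (sX _).
  have [h hE] := series_of_mpolyX K e; have [l lE] := phi_ev h.
  by exists l; rewrite lE /ev /= -/som hE /lval /= series_map_X.
pose C := residue m; pose b := max_drop S.
pose A : 'M_#|C| := \matrix_(i, j) transition hm p w (enum_val i) (enum_val j).
pose f n : 'cV_#|C| := \col_i state_poly hm p w i0 j0 n (enum_val i).
have f_rec n : f n.+1 = map_mx (drop_poly b) (A *m f n).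
  apply/colP => i; rewrite !mxE state_poly_rec //; congr drop_poly.
  rewrite (reindex _ (onW_bij _ (enum_val_bij C))) /=.
  by apply: eq_bigr => j _; rewrite !mxE.
(* The kernel method applies to each state separately, evaluated at the element [varx] of the
   coefficient field K(x, y); a finite sum of algebraic elements is algebraic. *)
have -> : lval (walk_gf hm p w i0 j0)
    = \sum_i Series (fun n => (f n i 0).[varx K e]).
  apply: seriesP => n; rewrite scoef_sum -[LHS]sum_state_poly //.
  rewrite (reindex _ (onW_bij _ (enum_val_bij C))) /=.
  by apply: eq_bigr => i _; rewrite mxE.
rewrite rmorph_sum; elim/big_ind: _ => [|u v|i _].
- exact: algebraic0.
- exact: algebraic_add.
- exact: (kernel_algebraic phi_const phi_X f_rec).
Qed.
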